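(* Let $m,n\in\mathbb N_0$ with $m\le n$, let $p,q\in\mathbb N_1$ with $p\le q$, and let $g\colon[q]\to[p]$ be surjective. Then, as maps from the probability measures on $\mathcal A^{(q)}_n$ to the probability measures on $\mathcal A^{(p)}_m$, $$(g^{\deg})_\sharp\circ\sigma^{(q)}_{m,n}=\sigma^{(p)}_{m,n}\circ(g^{\deg})_\sharp .$$
   Context: Notation: $\mathbb N_1=\{1,2,\dots\}$, $\mathbb N_0=\{0,1,\dots\}$, $[q]=\{1,\dots,q\}$, $\mathbb N^q_*=\mathbb N_0^q\setminus\{\mathbf 0\}$; $|\mathbf a|=\sum_ja_j$; $\mathbf e_j$ canonical basis vectors. A $q$-chromatic partition of $n$ is a finitely supported map $A\colon\mathbb N^q_*\to\mathbb N_0$ with $\sum_{\mathbf a}A(\mathbf a)|\mathbf a|=n$; $\mathcal A^{(q)}_n$ is the set of these ($\mathcal A^{(q)}_0=\{0\}$); $\mathbf 1_{\mathbf a}$ is the multiset with single element $\mathbf a$; operations pointwise. Deletion kernels: for $\mathbf a\in\mathrm{supp}A$, $a_j\ge1$, $A_{\setminus\mathbf a,j}=A-\mathbf 1_{\mathbf a}$ if $\mathbf a=\mathbf e_j$, else $A-\mathbf 1_{\mathbf a}+\mathbf 1_{\mathbf a-\mathbf e_j}$. $S^{(q)}_{n,n}(A,B)=1$ if $A=B$, else $0$; for $A\in\mathcal A^{(q)}_n$, $B\in\mathcal A^{(q)}_{n-1}$, $S^{(q)}_{n-1,n}(A,B)=a_jA(\mathbf a)/n$ if $B=A_{\setminus\mathbf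 a,j}$, and $0$ otherwise; $S^{(q)}_{\ell,n}(A,C)=\sum_{B\in\mathcal A^{(q)}_m}S^{(q)}_{\ell,m}(B,C)S^{(q)}_{m,n}(A,B)$ for $\ell<m<n$. For a probability $P_n$ on $\mathcal A^{(q)}_n$ and $m\le n$, $(\sigma^{(q)}_{m,n}P_n)[B]=\sum_{A\in\mathcal A^{(q)}_n}P_n[A]\,S^{(q)}_{m,n}(A,B)$, $B\in\mathcal A^{(q)}_m$. Degeneracy map: $g\colon[q]\to[p]$ induces $g_\sharp\colon\mathbb N^q_*\to\mathbb N^p_*$, $(g_\sharp\mathbf a)_k=\sum_{j\in g^{-1}(k)}a_j$, and $g^{\deg}\colon\mathcal A^{(q)}_n\to\mathcal A^{(p)}_n$, $g^{\deg}(A)=\sum_{\mathbf a\in\mathrm{supp}A}A(\mathbf a)\,\mathbf 1_{g_\sharp\mathbf a}$ (colors with the same image under $g$ are identified). $(g^{\deg})_\sharp$ is the push-forward of measures under $g^{\deg}$. *)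

(* Defs.v *)
From HB Require Import structures.
From mathcomp Require Import all_boot all_order all_algebra finmap multiset.
From mathcomp Require Import all_classical all_reals all_analysis.

Set Implicit Arguments.
Unset Strict Implicit.
Unset Printing Implicit Defensive.

Import Order.TTheory GRing.Theory Num.Theory.

Local Open Scope fset_scope.
Local Open Scope mset_scope.
Local Open Scope nat_scope.

Definition Nstar (q : nat) := {a : {ffun 'I_q -> nat} | a != [ffun=> 0]}.

Definition unitv (q : nat) (j : 'I_q) : {ffun 'I_q -> nat} :=
  [ffun i => (i == j) : nat].

Definition vabs (q : nat) (a : {ffun 'I_q -> nat}) : nat := \sum_(j < q) a j.

Definition mweight (q : nat) (A : {mset Nstar q}) : nat :=
  \sum_(a <- finsupp A) A a * vabs (val a).

(* Finitely supported maps Nstar q -> nat are finite multisets. *)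
Record chrompart (q n : nat) := Chrompart {
  cpval :> {mset Nstar q};
  cpP : mweight cpval == n }.

HB.instance Definition _ q n := [isSub for @cpval q n].
HB.instance Definition _ q n := [Choice of chrompart q n by <:].

Section Weight.
Variable q : nat.
Implicit Types (A B : {mset Nstar q}) (a b : Nstar q) (j : 'I_q).

Lemma mweightE A : mweight A = \sum_(a <- A) vabs (val a).
Proof. by rewrite /mweight sum_mset. Qed.

Lemma mweight0 : mweight (mset0 : {mset Nstar q}) = 0.
Proof. by rewrite mweightE enum_mset0 big_nil. Qed.

Lemma mweightn k a : mweight (msetn k a) = k * vabs (val a).
Proof. by rewrite mweightE enum_msetn big_nseq iter_addn addn0 mulnC. Qed.

Lemma mweightD A B : mweight (A `+` B) = mweight A + mweight B.
Proof.
rewrite !mweightE -big_cat; apply: perm_big.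
by apply/allP => x _ /=; rewrite count_cat !count_mem_mset msetE2.
Qed.

Lemma vabs_gt0 a : 0 < vabs (val a).
Proof.
rewrite lt0n; apply/negP; rewrite sum_nat_eq0 => /forallP h.
by move/eqP: (valP a); apply; apply/ffunP => i; rewrite ffunE; apply/eqP/(implyP (h i)).
Qed.

Lemma leq_mweight A a : A a * vabs (val a) <= mweight A.
Proof.
case: (finsuppP A a) => [_|ha]; first by [].
by rewrite /mweight (big_fsetD1 a ha) leq_addr.
Qed.

End Weight.

Section Finite.
Variables q n : nat.

Let code (A : chrompart q n) : {ffun {ffun 'I_q -> 'I_n.+1} -> 'I_n.+1} :=
  [ffun b : {ffun 'I_q -> 'I_n.+1} =>
    inord (oapp (cpval A) 0
      (insub [ffun i => b i : nat] : option (Nstar q)))].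

Lemma chrompart_code_inj : injective code.
Proof.
move=> A B /ffunP eAB; apply/val_inj/msetP => a /=.
have hle (C : chrompart q n) : cpval C a * vabs (val a) <= n.
  by rewrite -[X in _ <= X](eqP (cpP C)) leq_mweight.
have hle1 (C : chrompart q n) : cpval C a <= n.
  by apply: leq_trans (hle C); rewrite leq_pmulr ?vabs_gt0.
have [ha|ha] := leqP (vabs (val a)) n; last first.
  have h0 (C : chrompart q n) : cpval C a = 0.
    case E : (cpval C a) => [//|k]; have := hle C.
    by rewrite E leqNgt (leq_trans ha)// leq_pmull.
  by rewrite !h0.
have hi i : val a i < n.+1.
  by rewrite ltnS (leq_trans _ ha)// /vabs (bigD1 i)//= leq_addr.
have := eAB [ffun i => Ordinal (hi i)]; rewrite !ffunE.
have -> : [ffun i => [ffun i => Ordinal (hi i)] i : nat] = val a.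
  by apply/ffunP => i; rewrite !ffunE.
by rewrite valK /= => /(congr1 val); rewrite /= !inordK ?ltnS ?hle1.
Qed.

Let decode u : option (chrompart q n) :=
  if pselect (exists A, code A == u) is left H then Some (xchoose H) else None.

Lemma chrompart_codeK : pcancel code decode.
Proof.
move=> A; rewrite /decode; case: pselect => [H|[]]; last by exists A.
by congr Some; apply: chrompart_code_inj; apply/eqP; exact: (xchooseP H).
Qed.

HB.instance Definition _ :=
  Choice_isCountable.Build (chrompart q n) (@pcan_pickleK _ _ _ _ chrompart_codeK).
HB.instance Definition _ :=
  fintype.isFinite.Build (chrompart q n) (@pcan_enumP (chrompart q n) _ _ _ chrompart_codeK).
End Finite.

Section Deletion.
Variable q : nat.
Implicit Types (A B : {mset Nstar q}) (a b : Nstar q) (j : 'I_q).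

(* The default of insubd is reached only when j is not in the support of a. *)
Definition del A a j : {mset Nstar q} :=
  if val a == unitv j then A `\ a
  else (A `\ a) `+` [mset insubd a [ffun i => val a i - unitv j i]].

Definition delpair A (x : finsupp A * 'I_q) : bool := 0 < val (val x.1) x.2.

Lemma unitv_le a j : 0 < val a j -> forall i, unitv j i <= val a i.
Proof. by move=> h i; rewrite ffunE; case: eqP => // ->. Qed.

Lemma val_predv a j : 0 < val a j -> val a != unitv j ->
  val (insubd a [ffun i => val a i - unitv j i]) = [ffun i => val a i - unitv j i].
Proof.
move=> aj anj; rewrite insubdK// -topredE /=; apply: contra anj => /eqP /ffunP e.
apply/eqP/ffunP => i; have := e i; rewrite !ffunE => /eqP.
rewrite subn_eq0 => le; apply/eqP; rewrite eqn_leq le /=.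
by have := unitv_le aj i; rewrite ffunE.
Qed.

Lemma predv_neq a j : 0 < val a j -> val a != unitv j ->
  insubd a [ffun i => val a i - unitv j i] != a.
Proof.
move=> aj anj; apply/negP => /eqP /(congr1 val); rewrite val_predv// => /ffunP /(_ j).
rewrite !ffunE eqxx => e; move: aj; rewrite -e; case: (val a j) e => [//|k].
by rewrite subn1 /= => /n_Sn.
Qed.

Lemma del_inj A a a' j j' : a \in finsupp A -> a' \in finsupp A ->
  0 < val a j -> 0 < val a' j' -> del A a j = del A a' j' -> a = a' /\ j = j'.
Proof.
move=> aA a'A aj a'j' e.
have del_at c k : c \in finsupp A -> 0 < val c k -> del A c k c = A c - 1.
  move=> cA ck; rewrite /del; case: ifPn => h; first by rewrite msetB1E eqxx.
  by rewrite msetE2 msetB1E msetnE eqxx eq_sym (negPf (predv_neq ck h)) addn0.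
have aa' : a = a'.
  apply/eqP/negP => /negP naa'.
  have : A a <= del A a' j' a.
    rewrite /del; case: ifPn => h; first by rewrite msetB1E (negPf naa') subn0.
    by rewrite msetE2 msetB1E (negPf naa') subn0 leq_addr.
  rewrite -e del_at// => h.
  have : 0 < A a by rewrite lt0n -mem_finsupp.
  by move: h; case: (A a) => [//|k]; rewrite subn1 /= ltnn.
subst a'; split=> //; move: e; rewrite /del.
have uE k i : 0 < val a i -> val a = unitv k -> i = k.
  by move=> + E; rewrite E ffunE; case: eqP.
case: ifPn => [/eqP h _|h]; first by rewrite (uE _ _ a'j' h).
case: ifPn => [/eqP h' _|h']; first by rewrite (uE _ _ aj h').
move=> /(congr1 (fun X => X `\` (A `\ a))); rewrite !(msetDKB (A `\ a)).
set b := insubd _ _; set b' := insubd _ _ => ebb.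
have /(congr1 val) : b = b'.
  move/msetP: ebb => /(_ b); rewrite !msetnE eqxx; by case: eqP.
rewrite /b /b' !val_predv// => /ffunP /(_ j); rewrite !ffunE eqxx.
case: (eqVneq j j') => // _; rewrite subn0 => E.
by move: aj; rewrite -E; case: (val a j) E => [//|k]; rewrite subn1 /= => /n_Sn.
Qed.

Lemma vabs_unitv j : vabs (unitv j) = 1.
Proof.
rewrite /vabs (bigD1 j)//= ffunE eqxx big1 ?addn0// => i.
by rewrite ffunE => /negPf ->.
Qed.

Lemma mweight_del A a j : a \in finsupp A -> 0 < val a j ->
  (mweight (del A a j)).+1 = mweight A.
Proof.
move=> aA aj.
have {2}-> : A = a +` (A `\ a) by rewrite msetB1K// -msuppE.
rewrite mweightD mweightn mul1n /del; case: ifPn => [/eqP ->|h].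
  by rewrite vabs_unitv add1n.
rewrite mweightD mweightn mul1n val_predv// [RHS]addnC -addnS; congr addn.
rewrite -addn1 -(vabs_unitv j) /vabs -big_split; apply: eq_bigr => i _ /=.
by rewrite ffunE subnK// unitv_le.
Qed.

Lemma sum_delpair A :
  \sum_(x : finsupp A * 'I_q | delpair x) val (val x.1) x.2 * A (val x.1) = mweight A.
Proof.
have -> : mweight A = \sum_(x : finsupp A * 'I_q) val (val x.1) x.2 * A (val x.1).
  rewrite -(pair_bigA _ (fun (a : finsupp A) j => val (val a) j * A (val a))) /=.
  rewrite /mweight big_seq_fsetE; apply: eq_bigr => a _ /=.
  by rewrite /vabs mulnC big_distrl.
rewrite big_mkcond; apply: eq_bigr => x _; rewrite /delpair.
by case: (posnP (val (val x.1) x.2)) => [->|].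
Qed.

End Deletion.

Section Kernel.
Local Open Scope ring_scope.
Variables (R : realType) (q : nat).

(* The pair (a, j) picked with B = del A a j is unique by del_inj, see delk1_del. *)
Definition delk1 (n : nat) (A : chrompart q n.+1) (B : chrompart q n) : R :=
  if [pick x : finsupp (cpval A) * 'I_q
     | delpair x && (cpval B == del A (val x.1) x.2)] is Some x
  then (val (val x.1) x.2)%:R * (cpval A (val x.1))%:R / n.+1%:R
  else 0.

Lemma delk1_del n (A : chrompart q n.+1) (B : chrompart q n) (a : Nstar q) (j : 'I_q) :
  a \in finsupp (cpval A) -> (0 < val a j)%N -> cpval B = del A a j ->
  delk1 A B = (val a j)%:R * (cpval A a)%:R / n.+1%:R.
Proof.
move=> aA aj e; rewrite /delk1; case: pickP => [[[b bA] k] /= /andP[bk /eqP e']|].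
  by have [? ?] := @del_inj _ _ b a k j bA aA bk aj (etrans (esym e') e); subst b k.
by move=> /(_ ([` aA], j)); rewrite /delpair /= aj e eqxx.
Qed.

Lemma delk1_sumE n (A : chrompart q n.+1) (B : chrompart q n) :
  delk1 A B = \sum_(x : finsupp (cpval A) * 'I_q | delpair x)
    (cpval B == del A (val x.1) x.2)%:R
    * ((val (val x.1) x.2)%:R * (cpval A (val x.1))%:R / n.+1%:R).
Proof.
rewrite /delk1; case: pickP => [x /andP[xd /eqP xe]|h].
  rewrite (bigD1 x)//= xe eqxx mul1r big1 ?addr0// => y /andP[yd yx].
  case: eqP; rewrite ?mul0r// => e; case/eqP: yx.
  case: x y xd yd e {xe} => [[b bA] k] [[c cA] l] /= bk cl e.
  have [bc ->] := @del_inj _ _ b c k l bA cA bk cl e; by congr (_, _); apply/val_inj/esym.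
by rewrite big1// => x xd; have := h x; rewrite xd /= => ->; rewrite mul0r.
Qed.

Lemma delk1_ge0 n (A : chrompart q n.+1) (B : chrompart q n) : 0 <= delk1 A B.
Proof. by rewrite /delk1; case: pickP => // x _; rewrite !mulr_ge0// invr_ge0. Qed.

Lemma delk1_sum1 n (A : chrompart q n.+1) : \sum_(B : chrompart q n) delk1 A B = 1.
Proof.
under eq_bigr do rewrite delk1_sumE.
rewrite exchange_big /=.
transitivity (\sum_(x : finsupp (cpval A) * 'I_q | delpair x)
    (val (val x.1) x.2 * cpval A (val x.1))%:R / n.+1%:R : R).
  apply: eq_bigr => -[[a aA] j] xd.
  have w : mweight (del (cpval A) a j) == n.
    by rewrite -eqSS mweight_del//; exact: cpP.
  rewrite (bigD1 (Chrompart w))//= eqxx mul1r big1 ?addr0 ?natrM//.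
  move=> B nB; case: eqP; rewrite ?mul0r// => e; case/eqP: nB; exact/val_inj.
rewrite -mulr_suml -natr_sum sum_delpair (eqP (cpP A)) divff//.
Qed.

(* One-step kernels are composed along n - 1, n - 2, ..., m + 1; the composition
   rule for an arbitrary intermediate size is delk_comp. The value is 0 if n < m. *)
Fixpoint delk (m n : nat) : chrompart q n -> chrompart q m -> R :=
  match n with
  | 0 => fun A B => (cpval A == cpval B)%:R
  | n'.+1 => fun A C =>
      if (m <= n')%N then \sum_(B : chrompart q n') delk B C * delk1 A B
      else (cpval A == cpval C)%:R
  end.

Lemma delk_nn n (A B : chrompart q n) : delk A B = (A == B)%:R.
Proof. by case: n A B => [|n] A B //=; rewrite ltnn. Qed.

Lemma delk_delk1 n (A : chrompart q n.+1) (B : chrompart q n) : delk A B = delk1 A B.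
Proof.
rewrite /= leqnn (bigD1 B)//= delk_nn eqxx mul1r big1 ?addr0// => C /negPf nCB.
by rewrite delk_nn nCB mul0r.
Qed.

Lemma delk_comp l m n (A : chrompart q n) (C : chrompart q l) : (l < m < n)%N ->
  delk A C = \sum_(B : chrompart q m) delk B C * delk A B.
Proof.
elim: n A => [|n IH] A; first by rewrite ltn0 andbF.
case/andP=> lm mn; rewrite [LHS]/= -ltnS (ltn_trans lm mn).
move: mn; rewrite ltnS leq_eqVlt => /orP[/eqP e|mn].
  by subst m; apply: eq_bigr => B _; rewrite (delk_delk1 A B).
under eq_bigr => B _ do rewrite IH ?lm// mulr_suml.
rewrite exchange_big /=; apply: eq_bigr => B _.
by rewrite (ltnW mn) mulr_sumr; apply: eq_bigr => D _; rewrite mulrA.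
Qed.

Lemma delk_ge0 m n (A : chrompart q n) (B : chrompart q m) : 0 <= delk A B.
Proof.
elim: n A => [|n IH] A /=; first by rewrite ler0n.
by case: ifP => _ //; apply: sumr_ge0 => C _; rewrite mulr_ge0 ?delk1_ge0.
Qed.

Lemma delk_sum1 m n (A : chrompart q n) : (m <= n)%N ->
  \sum_(B : chrompart q m) delk A B = 1.
Proof.
have nn k (D : chrompart q k) : \sum_(B : chrompart q k) delk D B = 1.
  rewrite (bigD1 D)//= delk_nn eqxx big1 ?addr0// => B /negPf nBD.
  by rewrite delk_nn eq_sym nBD.
elim: n A => [|n IH] A; first by rewrite leqn0 => /eqP e; subst m; exact: nn.
rewrite leq_eqVlt => /orP[/eqP e|mn]; first by subst m; exact: nn.
rewrite /= -ltnS mn exchange_big /= -[RHS](delk1_sum1 A).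
by apply: eq_bigr => B _; rewrite -mulr_suml IH ?mul1r.
Qed.

End Kernel.

Section Degeneracy.
Variables (p q : nat) (g : 'I_q -> 'I_p).

Definition gsharp_fun (a : {ffun 'I_q -> nat}) : {ffun 'I_p -> nat} :=
  [ffun k => \sum_(j < q | g j == k) a j].

Lemma vabs_gsharp a : vabs (gsharp_fun a) = vabs a.
Proof.
rewrite /vabs [RHS](partition_big g predT)//=.
by apply: eq_bigr => k _; rewrite ffunE.
Qed.

Lemma gsharp_neq0 (a : Nstar q) : gsharp_fun (val a) != [ffun=> 0].
Proof.
apply/eqP => e; have := vabs_gt0 a; rewrite -vabs_gsharp e /vabs big1// => i _.
by rewrite ffunE.
Qed.

Definition gsharp (a : Nstar q) : Nstar p := 
  exist (fun b : {ffun 'I_p -> nat} => b != [ffun=> 0]) _ (gsharp_neq0 a).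

Definition gdeg_mset (A : {mset Nstar q}) : {mset Nstar p} :=
  \big[(@msetD _)/mset0]_(a <- finsupp A) msetn (A a) (gsharp a).

Lemma mweight_gdeg A : mweight (gdeg_mset A) = mweight A.
Proof.
rewrite /gdeg_mset (big_morph (@mweight p) (@mweightD p) (mweight0 p)).
by apply: eq_bigr => a _; rewrite mweightn vabs_gsharp.
Qed.

Lemma gdeg_proof n (A : chrompart q n) : mweight (gdeg_mset A) == n.
Proof. by rewrite mweight_gdeg (cpP A). Qed.

Definition gdeg n (A : chrompart q n) : chrompart p n := Chrompart (gdeg_proof A).

End Degeneracy.

(* An inhabitant, required by measurableType: n singletons of color 0. Since it
   needs a color, the measurable structure is put on chrompart q.+1 n. *)
Lemma unitv_neq0 q (j : 'I_q) : unitv j != [ffun=> 0].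
Proof. by apply/eqP => /ffunP /(_ j); rewrite !ffunE eqxx. Qed.

Lemma chrompart_point q n :
  mweight (msetn n (exist (fun b : {ffun 'I_q.+1 -> nat} => b != [ffun=> 0]) _
    (unitv_neq0 ord0))) == n.
Proof. by rewrite mweightn vabs_unitv muln1. Qed.

HB.instance Definition _ q n :=
  isPointed.Build (chrompart q.+1 n) (Chrompart (chrompart_point q n)).

HB.instance Definition _ q n := @isMeasurable.Build default_measure_display
  (chrompart q.+1 n) discrete_measurable discrete_measurable0
  discrete_measurableC discrete_measurableU.

Section Sigma.
Local Open Scope classical_set_scope.
Local Open Scope ereal_scope.
Variables (R : realType) (q m n : nat).

Definition sigma_mass (P : probability (chrompart q.+1 n) R)
    (B : chrompart q.+1 m) : \bar R :=
  \sum_(A : chrompart q.+1 n) P [set A] * (delk R A B)%:E.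

(* The hypothesis m <= n ensures that the total mass is 1. *)
Definition sigma_fun (hmn : (m <= n)%N) (P : probability (chrompart q.+1 n) R)
    (U : set (chrompart q.+1 m)) : \bar R :=
  \sum_(B : chrompart q.+1 m | B \in U) sigma_mass P B.

Variables (hmn : (m <= n)%N) (P : probability (chrompart q.+1 n) R).

Lemma sigma_mass_ge0 B : 0 <= sigma_mass P B.
Proof. by apply: sume_ge0 => A _; rewrite mule_ge0// lee_fin delk_ge0. Qed.

Let sigma0 : sigma_fun hmn P set0 = 0.
Proof. by rewrite /sigma_fun big1// => B; rewrite in_set0. Qed.

Let sigma_ge0 U : 0 <= sigma_fun hmn P U.
Proof. by apply: sume_ge0 => B _; exact: sigma_mass_ge0. Qed.

Let sigma_mass_fin B : sigma_mass P B \is a fin_num.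
Proof.
by apply/sum_fin_numP => A _ _; rewrite fin_numM// fin_num_measure.
Qed.

Let sigmaE U : sigma_fun hmn P U =
  \sum_(B : chrompart q.+1 m) sigma_mass P B * dirac B U.
Proof.
rewrite /sigma_fun big_mkcond; apply: eq_bigr => B _.
by rewrite diracE; case: (B \in U); rewrite ?mule1 ?mule0.
Qed.

Let sigma_additive : semi_sigma_additive (sigma_fun hmn P).
Proof.
move=> F mF tF mUF; rewrite sigmaE.
rewrite [X in X @ _ --> _](_ : _ = (fun k =>
   \sum_(B : chrompart q.+1 m)
     sigma_mass P B * \sum_(0 <= i < k) dirac B (F i))); last first.
  apply/funext => k; under eq_bigr do rewrite sigmaE.
  rewrite exchange_big; apply: eq_bigr => B _.
  by rewrite ge0_sume_distrr.
apply: cvg_nnesum => B _.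
  by apply: nearW => k; rewrite mule_ge0 ?sigma_mass_ge0// sume_ge0.
by apply: cvgeZl => //; exact: (measure_semi_sigma_additive (s := dirac B)).
Qed.

HB.instance Definition _ := isMeasure.Build _ _ _ (sigma_fun hmn P)
  sigma0 sigma_ge0 sigma_additive.

Let sigmaT : sigma_fun hmn P setT = 1.
Proof.
rewrite /sigma_fun (eq_bigl xpredT); last by move=> B; rewrite in_setT.
rewrite exchange_big /=.
under eq_bigr => A _.
  rewrite -ge0_sume_distrr; last by move=> B _; rewrite lee_fin delk_ge0.
  rewrite sumEFin delk_sum1// mule1.
  over.
rewrite -(probability_setT P).
have tD : trivIset [set: chrompart q.+1 n] (fun A => [set id A]).
  by move=> A B _ _ [C [-> ->]].
rewrite -[X in _ = P X](image_id setT) -bigcup_imset1.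
rewrite (measure_fin_bigcup P finite_finset tD)// fsbig_seq ?index_enum_uniq//.
by apply: eq_fsbigl; apply/seteqP; split => // A _ /=; rewrite mem_index_enum.
Qed.

HB.instance Definition _ :=
  Measure_isProbability.Build _ _ _ (sigma_fun hmn P) sigmaT.

End Sigma.

Definition sigma (R : realType) (q m n : nat) (hmn : (m <= n)%N)
    (P : probability (chrompart q.+1 n) R) : probability (chrompart q.+1 m) R :=
  sigma_fun hmn P.

Section Push.
Variables (R : realType) (p q : nat) (g : 'I_q.+1 -> 'I_p.+1) (n : nat).

HB.instance Definition _ := isMeasurableFun.Build _ _
  (chrompart q.+1 n) (chrompart p.+1 n) (@gdeg p.+1 q.+1 g n)
  (fun _ _ _ => I).

Definition gdeg_push (P : probability (chrompart q.+1 n) R) :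
    probability (chrompart p.+1 n) R :=
  distribution P (@gdeg p.+1 q.+1 g n).

End Push.

Lemma sigma_set1 (R : realType) (q m n : nat) (hmn : (m <= n)%N)
    (P : probability (chrompart q.+1 n) R) (B : chrompart q.+1 m) :
  sigma hmn P [set B]%classic =
  (\sum_(A : chrompart q.+1 n) P [set A]%classic * (delk R A B)%:E)%E.
Proof.
rewrite /sigma /= /sigma_fun (eq_bigl (pred1 B)) ?big_pred1_eq// => C.
by apply/idP/idP => [/set_mem -> /=|/eqP ->]; rewrite ?eqxx ?inE.
Qed.

Lemma gdeg_pushE (R : realType) (p q n : nat) (g : 'I_q.+1 -> 'I_p.+1)
    (P : probability (chrompart q.+1 n) R) :
  gdeg_push g P = pushforward P (@gdeg _ _ g n) :> (set _ -> \bar R).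
Proof. by []. Qed.

Arguments sigma {R q m n} hmn P.
Arguments gdeg_push {R p q} g {n} P.

(* Main.v *)
Require Import Defs.
From mathcomp Require Import all_boot all_order all_algebra finmap multiset.
From mathcomp Require Import all_classical all_reals all_analysis.

Set Implicit Arguments.
Unset Strict Implicit.
Unset Printing Implicit Defensive.
Import GRing.Theory.
Local Open Scope fset_scope.
Local Open Scope mset_scope.
Local Open Scope nat_scope.

(** The point is that the degeneracy map is equivariant for the deletion of a
    single colored unit: a partition of [n] into colored parts is a collection
    of [n] colored units grouped into parts, the one-step deletion kernel
    removes one of the [n] units uniformly at random, and the map [gdeg g] only
    renames the colors of the units. Removing a unit of color [j] from a part
    [a] and then renaming colors is therefore the same as renaming first and
    removing a unit of color [g j] from the part [gsharp g a]
    ([gdeg_mset_del]).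

    To turn this into an identity between kernels, the transition probability
    is written as a sum over the parts of [A] taken with multiplicity
    ([delk1_sum_enum]); this form is transported to [gdeg g A] by a plain change
    of variables, because the parts of [gdeg g A] are exactly the images of the
    parts of [A] ([perm_gdeg_mset]). A unit of color [k] in [gsharp g a] is a
    unit of [a] whose color is in the fiber of [k], which matches the weights and
    gives [delk1_gdeg]: the one-step kernel of [gdeg g A] is the image of the
    one-step kernel of [A]. The property survives composition of kernels, so it
    holds for [delk] ([delk_gdeg]), and integrating it against a probability
    gives the theorem. Since the spaces are finite and discrete, it is enough to
    compare masses of points ([probability_eq1]). *)

(** * Degeneracy of multisets and deletion *)

Section GdegMset.
Variables (p q : nat) (g : 'I_q -> 'I_p).
Implicit Types (A B : {mset Nstar q}) (a : Nstar q) (j : 'I_q).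

(** The definition of [gdeg_mset] goes through the support; listing parts with
    multiplicity makes it the image of a list, so that sums over
    [gdeg_mset g A] become sums over [A] by [perm_big] and [big_map]. *)
Lemma perm_gdeg_mset A : perm_eq (gdeg_mset g A) [seq gsharp g a | a <- A].
Proof.
apply/allP => b _ /=; rewrite count_mem_mset count_map; apply/eqP.
rewrite /gdeg_mset.
have hD : {morph (fun X : {mset Nstar p} => X b) : X Y / X `+` Y >-> X + Y}.
  by move=> X Y; rewrite msetE2.
rewrite (big_morph (fun X : {mset Nstar p} => X b) hD (mset0E b)).
rewrite -sum1_count sum_mset [RHS]big_mkcond /=; apply: eq_bigr => a _.
by rewrite msetnE eq_sym muln1.
Qed.

Lemma perm_enum_msetD (K : choiceType) (X Y : {mset K}) :
  perm_eq (X `+` Y) ((X : seq K) ++ Y).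
Proof. by apply/allP => x _ /=; rewrite count_cat !count_mem_mset msetE2. Qed.

Lemma gdeg_msetD A B : gdeg_mset g (A `+` B) = gdeg_mset g A `+` gdeg_mset g B.
Proof.
apply/msetP => b; rewrite msetE2 -!count_mem_mset !(permP (perm_gdeg_mset _)).
by rewrite (permP (perm_map _ (perm_enum_msetD A B))) map_cat count_cat.
Qed.

Lemma gdeg_mset1 a : gdeg_mset g [mset a] = [mset gsharp g a].
Proof.
apply/msetP => b; rewrite -!count_mem_mset (permP (perm_gdeg_mset _)).
by rewrite !enum_msetn.
Qed.

(** Being a unit vector, once color [j] occurs, depends only on the number of
    units; this is the form in which the property is invariant under
    degeneracy. *)
Lemma eq_unitv_vabs (r : nat) (a : {ffun 'I_r -> nat}) (j : 'I_r) : 0 < a j ->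
  (a == unitv j) = (vabs a == 1).
Proof.
move=> aj; apply/eqP/eqP => [->|]; first exact: vabs_unitv.
rewrite /vabs (bigD1 j)//=; case E : (a j) aj => [//|k] _ /eqP.
rewrite addSn eqSS addn_eq0 => /andP[/eqP k0]; rewrite sum_nat_eq0 => /forallP h.
apply/ffunP => i; rewrite ffunE; case: eqP => [->|/eqP ij]; first by rewrite E k0.
exact/eqP/(implyP (h i)).
Qed.

Lemma leq_gsharp (a : {ffun 'I_q -> nat}) j : a j <= gsharp_fun g a (g j).
Proof. by rewrite ffunE (bigD1 j)//= leq_addr. Qed.

Lemma gsharp_unitv j : gsharp_fun g (unitv j) = unitv (g j).
Proof.
apply/ffunP => k; rewrite !ffunE big_mkcond (bigD1 j)//= ffunE eqxx.
rewrite big1 ?addn0; last by move=> i /negPf ij; rewrite ffunE ij if_same.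
by rewrite eq_sym; case: eqP.
Qed.

(** Splitting [A] as [a] together with [A `\ a] and using additivity reduces the
    claim to the part [a]. Degeneracy preserves the number of units of a part,
    so [a] disappears altogether exactly when [gsharp g a] does. *)
Lemma gdeg_mset_del A a j : a \in finsupp A -> 0 < val a j ->
  gdeg_mset g (del A a j) = del (gdeg_mset g A) (gsharp g a) (g j).
Proof.
move=> aA aj.
have gaj : 0 < val (gsharp g a) (g j) by exact: leq_trans (leq_gsharp _ _).
have gA : gdeg_mset g A `\ gsharp g a = gdeg_mset g (A `\ a).
  have {1}-> : A = a +` (A `\ a) by rewrite msetB1K// -msuppE.
  by rewrite gdeg_msetD gdeg_mset1 msetDKB.
have un : (val (gsharp g a) == unitv (g j)) = (val a == unitv j).
  by rewrite !eq_unitv_vabs// vabs_gsharp.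
rewrite /del un gA; case: ifPn => // anj.
rewrite gdeg_msetD gdeg_mset1; congr (_ `+` [mset _]).
apply/val_inj; rewrite val_predv ?un//=; apply/ffunP => k.
rewrite -gsharp_unitv !ffunE val_predv// -sumnB => [|i _].
  by apply: eq_bigr => i _; rewrite ffunE.
exact: unitv_le.
Qed.

End GdegMset.

(** * Degeneracy and the deletion kernels *)

Section Kernel.
Local Open Scope ring_scope.
Variable R : realType.

(** Enumerating [A] with multiplicity absorbs the factor [A a], and pairs with
    [val a j = 0] contribute nothing, so that neither the support of [A] nor
    that of [a] appears in the sum. The multiplicities and the supports do not
    behave well under degeneracy, since distinct parts may get the same image. *)
Lemma delk1_sum_enum q n (A : chrompart q n.+1) (B : chrompart q n) :
  delk1 R A B = \sum_(a <- cpval A) \sum_(j < q)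
    (val a j)%:R * (cpval B == del (cpval A) a j)%:R / n.+1%:R.
Proof.
rewrite delk1_sumE big_mset big_seq_fsetE /= big_mkcond.
rewrite -(pair_bigA _ (fun (a : finsupp (cpval A)) j => if delpair (a, j) then
  (cpval B == del (cpval A) (val a) j)%:R *
    ((val (val a) j)%:R * (cpval A (val a))%:R / n.+1%:R) else 0)) /=.
apply: eq_bigr => a _; rewrite Monoid.iteropE iter_addr_0 -[RHS]mulr_natr mulr_suml.
apply: eq_bigr => j _; rewrite /delpair /=; case: posnP => [->|_].
  by rewrite !mul0r.
by rewrite -!mulrA mulrCA; congr (_ * (_ * _)); exact: mulrC.
Qed.

Variables (p q : nat) (g : 'I_q -> 'I_p).

(** The pairs (part, color) of [gdeg g A] are grouped into fibers over [A]: the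
    parts by [perm_gdeg_mset], the colors of a part by the definition of
    [gsharp]. For each pair [(a, j)] exactly one [C] is reached, and
    [gdeg_mset_del] tells when its image is [B]. *)
Lemma delk1_gdeg n (A : chrompart q n.+1) (B : chrompart p n) :
  \sum_(C : chrompart q n | gdeg g C == B) delk1 R A C = delk1 R (gdeg g A) B.
Proof.
rewrite delk1_sum_enum (perm_big _ (perm_gdeg_mset g A)) big_map /=.
under eq_bigr do rewrite delk1_sum_enum.
rewrite exchange_big big_seq [RHS]big_seq; apply: eq_bigr => a aA /=.
rewrite exchange_big [RHS](eq_bigr (fun k => \sum_(j < q | g j == k)
  (val a j)%:R * (cpval B == del (gdeg_mset g A) (gsharp g a) (g j))%:R / n.+1%:R)).
  rewrite (partition_big g xpredT)//=; apply: eq_bigr => k _.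
  apply: eq_bigr => j _.
  (* Only if j occurs in a is del A a j a partition of n, that is, one of the C. *)
  have [->|aj] := posnP (val a j); first by rewrite big1 => [|C _]; rewrite ?mul0r.
  have aS : a \in finsupp (cpval A) by rewrite msuppE.
  have w : mweight (del (cpval A) a j) == n.
    by rewrite -eqSS mweight_del//; exact: cpP.
  rewrite big_mkcond (bigD1 (Chrompart w))//= eqxx big1 ?addr0 => [|C nC].
    rewrite -(gdeg_mset_del g aS aj) eq_sym -val_eqE /=.
    by case: eqP; rewrite ?mulr0 ?mul0r.
  case: ifP => // _; case: eqP; rewrite ?mulr0 ?mul0r// => e.
  by case/eqP: nC; exact/val_inj.
move=> k _; rewrite ffunE natr_sum !mulr_suml; apply: eq_bigr => j.
by move=> /eqP <-.
Qed.

(** Induction on [n]: in the composite kernel the intermediate partitions are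
    grouped according to their image under [gdeg g]. *)
Lemma delk_gdeg m n (A : chrompart q n) (B : chrompart p m) : (m <= n)%N ->
  \sum_(C : chrompart q m | gdeg g C == B) delk R A C = delk R (gdeg g A) B.
Proof.
have nn k (D : chrompart q k) (E : chrompart p k) :
    \sum_(C : chrompart q k | gdeg g C == E) delk R D C = delk R (gdeg g D) E.
  rewrite delk_nn big_mkcond (bigD1 D)//= delk_nn eqxx big1 ?addr0; first by case: eqP.
  by move=> C /negPf CD; rewrite delk_nn [D == C]eq_sym CD if_same.
elim: n A => [|n IH] A; first by rewrite leqn0 => /eqP e; subst m; exact: nn.
rewrite leq_eqVlt => /orP[/eqP e|]; first by subst m; exact: nn.
rewrite ltnS => mn.
rewrite /= mn exchange_big /=.
under eq_bigr do rewrite -mulr_suml IH//.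
under [RHS]eq_bigr do rewrite -delk1_gdeg mulr_sumr.
rewrite [LHS](partition_big (gdeg g (n := n)) xpredT)//=; apply: eq_bigr => C _.
by apply: eq_bigr => D /eqP ->.
Qed.

End Kernel.

(** * Probabilities on a finite discrete space *)

Section Measures.
Local Open Scope ereal_scope.

(** Apart from the underlying set function, a probability carries only proofs,
    which are irrelevant. *)
Lemma probability_eq d (T : measurableType d) (R : realType) (P Q : probability T R) :
  (P : set T -> \bar R) = Q -> P = Q.
Proof.
case: P Q => [P cP] [Q cQ] /= PQ; subst Q; congr Probability.Pack.
case: cP cQ => [[P1 P2] [P3] [P4] [P5] [P6] [P7] [P8]].
move=> [[Q1 Q2] [Q3] [Q4] [Q5] [Q6] [Q7] [Q8]].
have ? := Prop_irrelevance P1 Q1; subst Q1.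
have ? := Prop_irrelevance P2 Q2; subst Q2.
by f_equal; f_equal; exact: Prop_irrelevance.
Qed.

Lemma probability_sum1 (R : realType) q n (P : probability (chrompart q.+1 n) R)
    (U : set (chrompart q.+1 n)) :
  P U = \sum_(A : chrompart q.+1 n | A \in U) P [set A]%classic.
Proof.
have tU : trivIset U (fun A => [set id A])%classic.
  by move=> A B _ _ [C [-> ->]].
rewrite -[in LHS](image_id U) -bigcup_imset1.
rewrite (measure_fin_bigcup P finite_finset tU)//.
rewrite -[RHS]big_filter [RHS]fsbig_seq ?filter_uniq ?index_enum_uniq//.
apply: eq_fsbigl; apply/seteqP; split=> A /=; rewrite mem_filter mem_index_enum andbT.
  by move=> ?; apply/mem_set.
by move/set_mem.
Qed.

Lemma probability_eq1 (R : realType) q n (P Q : probability (chrompart q.+1 n) R) :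
  (forall A, P [set A]%classic = Q [set A]%classic) -> P = Q.
Proof.
move=> PQ; apply/probability_eq/funext => U.
by rewrite !probability_sum1; apply: eq_bigr => A _; exact: PQ.
Qed.

Lemma gdeg_push_set1 (R : realType) p q (g : 'I_q.+1 -> 'I_p.+1) n
    (P : probability (chrompart q.+1 n) R) (B : chrompart p.+1 n) :
  gdeg_push g P [set B]%classic =
  \sum_(A : chrompart q.+1 n | gdeg g A == B) P [set A]%classic.
Proof.
rewrite gdeg_pushE /pushforward probability_sum1; apply: eq_bigl => A.
by apply/idP/eqP => [/set_mem|<-]; rewrite ?inE.
Qed.

End Measures.

Theorem proposition5p33 (R : realType) (m n : nat) (hmn : (m <= n)%N)
    (p q : nat) (hpq : (p.+1 <= q.+1)%N) (g : 'I_q.+1 -> 'I_p.+1)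
    (gsurj : forall k : 'I_p.+1, exists j : 'I_q.+1, g j = k) :
  gdeg_push g \o sigma hmn = sigma hmn \o gdeg_push g
    :> (probability (chrompart q.+1 n) R -> probability (chrompart p.+1 m) R).
Proof.
apply/funext => P; apply: probability_eq1 => B.
transitivity (sigma hmn P (gdeg g (n := m) @^-1` [set B])%classic); first by [].
rewrite [RHS]sigma_set1 probability_sum1.
(* Both sides average a kernel over the law P; on the right, the partitions A
   are first collected according to their image under degeneracy. *)
under eq_bigr do rewrite sigma_set1.
rewrite exchange_big /=.
under [RHS]eq_bigr => A' _.
  rewrite gdeg_push_set1 ge0_sume_distrl//; over.
rewrite [LHS](partition_big (gdeg g (n := n)) xpredT)//=; apply: eq_bigr => A' _.
apply: eq_bigr => A /eqP <-.
rewrite -ge0_sume_distrr => [|C _]; last by rewrite lee_fin delk_ge0.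
rewrite sumEFin -delk_gdeg//; congr (_ * _%:E)%E; apply: eq_bigl => C.
by apply/idP/eqP => [/set_mem|<-]; rewrite ?inE.
Qed.
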